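(* Let $(X,d)$ be a metric space, $U$ a map from $X$ to $X$, $\varphi$ a map from $X\times X$ to $\mathbb{R}$ and $(u_n)_{n\in\mathbb{N}}$ a sequence of elements of $X$. Suppose that there are monotone functionals $\alpha$ and $\beta$ from $\mathbb{N}\times\mathbb{N}^{\mathbb{N}}$ to $\mathbb{N}$ satisfying: (a) for all $k\in\mathbb{N}$ and all monotone $f\in\mathbb{N}^{\mathbb{N}}$, $\exists N\leq\alpha(k,f)\ \forall n\in[N,f(N)]\left(d(U(u_n),u_n)<\frac{1}{k+1}\right)$; (b) for all $k\in\mathbb{N}$ and all monotone $f\in\mathbb{N}^{\mathbb{N}}$, there are $N\leq\beta(k,f)$ and $x\in X$ such that $$d(U(x),x)<\frac{1}{f(N)+1}\ \wedge\ \forall y\in X\left(d(U(y),y)\leq\frac{1}{N+1}\rightarrow\varphi(x,x)<\varphi(x,y)+\frac{1}{k+1}\right).$$ Then, for every $k\in\mathbb{N}$ and any monotone function $f\in\mathbb{N}^{\mathbb{N}}$, there is a natural number $N$ with $N\leq\psi(k,f)$ such that $$\exists x\in X\left(d(U(x),x)<\frac{1}{f(N)+1}\ \wedge\ \forall n\in[N,f(N)]\left(\varphi(x,x)<\varphi(x,u_n)+\frac{1}{k+1}\right)\right),$$ where $\psi(k,f)$ is the monotone functional given by $\psi(k,f):=\alpha(\beta(k,\widehat f),f)$, with $\widehat f$ the monotone function $m\mapsto f(\alpha(m,f))$.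
   Context: $[n,m]:=\{n,n+1,\ldots,m\}$ (empty if $m<n$). For $f,g\in\mathbb{N}^{\mathbb{N}}$, $g\leq^*f$ means $\forall n\forall k\leq n\,(g(k)\leq f(n)\wedge f(k)\leq f(n))$. A function $f\in\mathbb{N}^{\mathbb{N}}$ is monotone if $f\leq^*f$ (i.e. $f$ is nondecreasing). For functionals $\alpha,\beta:\mathbb{N}\times\mathbb{N}^{\mathbb{N}}\to\mathbb{N}$, $\alpha\leq^*\beta$ means $\forall n\forall f\forall k\leq n\forall g\leq^*f\,(\alpha(k,g)\leq\beta(n,f)\wedge\beta(k,g)\leq\beta(n,f))$; $\alpha$ is monotone if $\alpha\leq^*\alpha$. *)

(* Defs.v *)
From mathcomp Require Import all_boot.

Set Implicit Arguments.
Unset Strict Implicit.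
Unset Printing Implicit Defensive.

Local Open Scope nat_scope.

(* Bezem's strong majorizability. [le_star1 g f] and [le_star2 alpha beta] read
   "g <=* f" and "alpha <=* beta"; functionals on N x N^N are curried. *)

Definition le_star1 (g f : nat -> nat) : Prop :=
  forall n k, k <= n -> g k <= f n /\ f k <= f n.

Definition monotone1 (f : nat -> nat) : Prop := le_star1 f f.

Definition le_star2 (alpha beta : nat -> (nat -> nat) -> nat) : Prop :=
  forall (n : nat) (f : nat -> nat) (k : nat), k <= n ->
  forall g : nat -> nat, le_star1 g f ->
  alpha k g <= beta n f /\ beta k g <= beta n f.

Definition monotone2 (alpha : nat -> (nat -> nat) -> nat) : Prop :=
  le_star2 alpha alpha.

Definition fhat (alpha : nat -> (nat -> nat) -> nat) (f : nat -> nat) :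
  nat -> nat := fun m => f (alpha m f).

Definition psi (alpha beta : nat -> (nat -> nat) -> nat) (k : nat)
  (f : nat -> nat) : nat := alpha (beta k (fhat alpha f)) f.

(* Main.v *)
(* Apply (b) to the counterfunction [fhat alpha f], then (a) at the resulting
   precision [N0]: the point [x] obtained is an approximate fixed point up to
   [f (alpha N0 f)], which is at least [f N] for the witness [N <= alpha N0 f]
   of (a), while (a) makes every [u n] with [n] in [N, f N] a competitor [y]
   in (b). *)

Require Import Defs.
From mathcomp Require Import all_boot all_order all_algebra.
From mathcomp Require Import reals topology.

Set Implicit Arguments.
Unset Strict Implicit.
Unset Printing Implicit Defensive.

Import Order.TTheory GRing.Theory Num.Theory.
Local Open Scope ring_scope.

Lemma le_star1_right (g f : nat -> nat) : le_star1 g f -> monotone1 f.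
Proof. by move=> gf n k kn; have [_ ->] := gf n k kn. Qed.

(** The case [g = f] makes [fhat alpha f] a legitimate counterfunction for (b); distinct [g] and [f]
    are needed for the monotonicity of [psi]. *)
Lemma le_star1_fhat (alpha : nat -> (nat -> nat) -> nat) (g f : nat -> nat) :
  monotone2 alpha -> le_star1 g f -> le_star1 (fhat alpha g) (fhat alpha f).
Proof.
move=> malpha gf n k kn; split.
  by have [le_a _] := malpha n f k kn g gf; have [] := gf _ _ le_a.
(* The second conjunct involves [f] alone, so [alpha] is compared at [f] with itself. *)
have [le_a _] := malpha n f k kn f (le_star1_right gf).
by have [] := gf _ _ le_a.
Qed.

Lemma monotone2_psi (alpha beta : nat -> (nat -> nat) -> nat) :
  monotone2 alpha -> monotone2 beta -> monotone2 (psi alpha beta).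
Proof.
move=> malpha mbeta n f k kn g gf.
(* Both arguments of the outer [alpha] grow: the first by [le_b], the second by [gf]. *)
have [le_b _] := mbeta _ _ _ kn _ (le_star1_fhat malpha gf).
exact: malpha.
Qed.

Theorem proposition4p3 (R : realType) (X : metricType R) (U : X -> X)
    (phi : X -> X -> R) (u : nat -> X)
    (alpha beta : nat -> (nat -> nat) -> nat)
    (malpha : monotone2 alpha) (mbeta : monotone2 beta)
    (Ha : forall (k : nat) (f : nat -> nat), monotone1 f ->
      exists N : nat, (N <= alpha k f)%N /\
        forall n : nat, (N <= n <= f N)%N ->
          mdist (U (u n)) (u n) < 1 / (k%:R + 1))
    (Hb : forall (k : nat) (f : nat -> nat), monotone1 f ->
      exists (N : nat) (x : X), (N <= beta k f)%N /\
        mdist (U x) x < 1 / ((f N)%:R + 1) /\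
        forall y : X, mdist (U y) y <= 1 / (N%:R + 1) ->
          phi x x < phi x y + 1 / (k%:R + 1)) :
  (forall f : nat -> nat, monotone1 f -> monotone1 (fhat alpha f)) /\
  monotone2 (psi alpha beta) /\
  forall (k : nat) (f : nat -> nat), monotone1 f ->
    exists N : nat, (N <= psi alpha beta k f)%N /\
      exists x : X,
        mdist (U x) x < 1 / ((f N)%:R + 1) /\
        forall n : nat, (N <= n <= f N)%N ->
          phi x x < phi x (u n) + 1 / (k%:R + 1).
Proof.
split; first by move=> f mf; exact: le_star1_fhat.
split; first exact: monotone2_psi.
move=> k f mf.
have [N0 [x [leN0 [fixx minx]]]] := Hb k _ (le_star1_fhat malpha mf).
have [N [leN fixu]] := Ha N0 _ mf.
exists N; split.
  (* [N0] is known only up to [beta k (fhat alpha f)]; monotonicity of [alpha] turns the bound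
     [alpha N0 f] into [psi alpha beta k f]. *)
  by apply: leq_trans leN _; have [] := malpha _ f _ leN0 f mf.
exists x; split; last by move=> n nN; apply/minx/ltW/fixu.
apply: (lt_le_trans fixx); rewrite !div1r lef_pV2 ?posrE ?ltr_wpDl//.
by rewrite lerD2r ler_nat; have [] := mf _ _ leN.
Qed.
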